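(* Let $A$ be a finite quotient PID such that its ideal norm $N_A$ satisfies the quasi-triangle inequality, i.e. there exists a constant $C\in\mathbb{N}$ such that $N_A(x+y)\leq C\cdot(N_A(x)+N_A(y))$ for all $x,y\in A$. Let $B$ be a Dedekind domain which is a finitely generated and free $A$-module. Then $B$ is a ring of integers of a global field. In particular, if $A$ is a basic PID and $B$ is of class (G) over $A$, then $B$ is a ring of integers of a global field.
   Context: All rings are commutative with identity; $\mathbb{N}$ denotes the set of positive integers; PID stands for principal ideal domain. A Dedekind domain is an integral domain in which every nonzero proper ideal is, uniquely, a product of prime ideals. A finite quotient PID is a PID $A$ such that for every nonzero ideal $I$ of $A$ the quotient $A/I$ is a finite ring. The ideal norm on such an $A$ is the function $N_A:A\to\mathbb{N}\cup\{0\}$ given by $N_A(x)=|A/xA|$ for $x\neq 0$ and $N_A(0)=0$. A PID $A$ is called a basic PID if it is not a field and the following conditions are satisfied: (1) $A/I$ is finite for every nonzero ideal $I$ of $A$; (2) there exists a constant $c\in\mathbb{N}$ such that for each $m\in\mathbb{N}$, $\#\{x\in A\mid N_A(x)\leq c\cdot m\}\geq m$; (3) there exists a constant $C\in\mathbb{N}$ such that for all $x,y\in A$, $N_A(x+y)\leq C\cdot(N_A(x)+N_A(y))$. Let $A$ be a basic PID. A Dedekind domain $B$ is called a ring of class (G) over $A$ if $B$ is an $A$-algebra that is finitely generated and free as a module over $A$. A global field is either a finite extension of $\mathbb{Q}$ (number field case) or a finite separable extension of some $\mathbb{F}_q(t)$, where $\mathbb{F}_q$ is a finite field and $t$ is transcendental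 over $\mathbb{F}_q$ (function field case). A ring of integers of a global field $L$ is either the integral closure in $L$ of $\mathbb{Z}$ (in the number field case) or the integral closure in $L$ of $\mathbb{F}_q[t]$ for some $t\in L$ transcendental over $\mathbb{F}_q$ (in the function field case).
   Formalization: In the first assertion A is additionally assumed not to be a field; the claim fails for every field A (e.g. A = B = the complex numbers), since B is then a field and never a ring of integers of a global field. *)

(* Defs.v *)
From HB Require Import structures.
From mathcomp Require Import all_boot all_order all_algebra all_field.
From mathcomp Require Import finmap.
From mathcomp Require Import mathcomp_extra boolp classical_sets functions cardinality.

Set Implicit Arguments.
Unset Strict Implicit.
Unset Printing Implicit Defensive.

Import GRing.Theory.
Local Open Scope classical_set_scope.
Local Open Scope card_scope.
Local Open Scope ring_scope.

(* MathComp's [idealr_closed] describes proper ideals only; here the unit ideal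
   is an ideal. *)
Definition is_ideal (R : comNzRingType) (I : set R) : Prop :=
  [/\ I 0,
      forall x y, I x -> I y -> I (x + y)
    & forall a x, I x -> I (a * x)].

Definition principal_ideal (R : comNzRingType) (x : R) : set R :=
  range (fun r : R => x * r).

(* The underlying set of R / I, as the set of cosets a + I. *)
Definition cosets (R : comNzRingType) (I : set R) : set (set R) :=
  range (fun a : R => [set b | I (b - a)]).

Definition is_PID (A : idomainType) : Prop :=
  forall I : set A, is_ideal I -> exists a : A, I = principal_ideal a.

Definition finite_quotients (A : idomainType) : Prop :=
  forall I : set A, is_ideal I -> I <> [set 0] -> finite_set (cosets I).

Definition is_finite_quotient_PID (A : idomainType) : Prop :=
  is_PID A /\ finite_quotients A.

(* [fset_set] is the empty set on an infinite argument; this value is never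
   reached when A has finite quotients. *)
Definition ideal_norm (A : idomainType) (x : A) : nat :=
  if x == 0 then 0%N else #|` fset_set (cosets (principal_ideal x))|.

Definition quasi_triangle (A : idomainType) : Prop :=
  exists C : nat, (0 < C)%N /\
    forall x y : A,
      (ideal_norm (x + y) <= C * (ideal_norm x + ideal_norm y))%N.

(* The set of elements of bounded norm may be infinite, hence the comparison of
   cardinals [#<=]. *)
Definition norm_abundant (A : idomainType) : Prop :=
  exists c : nat, (0 < c)%N /\
    forall m : nat, (0 < m)%N ->
      `I_m #<= [set x : A | (ideal_norm x <= c * m)%N].

Definition is_basic_PID (A : idomainType) : Prop :=
  [/\ is_PID A, ~ GRing.field_axiom A, finite_quotients A,
      norm_abundant A & quasi_triangle A].

Definition is_prime_ideal (R : comNzRingType) (P : set R) : Prop :=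
  [/\ is_ideal P, P <> setT
    & forall x y, P (x * y) -> P x \/ P y].

Definition ideal_mul (R : comNzRingType) (I J : set R) : set R :=
  [set z | exists s : seq (R * R),
     (forall p, p \in s -> I p.1 /\ J p.2) /\ z = \sum_(p <- s) p.1 * p.2].

Definition ideal_prod (R : comNzRingType) (s : seq (set R)) : set R :=
  foldr (@ideal_mul R) setT s.

Definition prime_factorization (R : comNzRingType) (I : set R)
    (s : seq (set R)) : Prop :=
  (forall P, P \in s -> is_prime_ideal P) /\ I = ideal_prod s.

(* Stated for [comNzRingType] because MathComp has no structure joining
   [idomainType] with A-algebras. *)
Definition is_Dedekind_domain (R : comNzRingType) : Prop :=
  GRing.integral_domain_axiom R /\
  forall I : set R, is_ideal I -> I <> [set 0] -> I <> setT ->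
    exists2 s, prime_factorization I s &
      forall s', prime_factorization I s' -> perm_eq s s'.

Definition fg_free_module (A : nzRingType) (M : lmodType A) : Prop :=
  exists (n : nat) (e : 'I_n -> M),
    forall v : M, exists! c : {ffun 'I_n -> A}, v = \sum_(i < n) c i *: e i.

Definition is_class_G (A : idomainType) (B : comAlgType A) : Prop :=
  is_Dedekind_domain B /\ fg_free_module B.

(* [iota] identifies B with the integral closure in L of the image of [f]. *)
Definition is_integral_closure (R B L : nzRingType) (f : R -> L)
    (iota : B -> L) : Prop :=
  injective iota /\ forall x : L, integralOver f x <-> range iota x.

(* A [fieldExtType rat] is a finite extension of Q. *)
Definition is_number_field_integers (B : comNzRingType) : Prop :=
  exists (L : fieldExtType rat) (iota : {rmorphism B -> L}),
    is_integral_closure (fun m : int => m%:~R : L) iota.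

(* The embedding of the constants F into an extension L of F(t). *)
Definition const_emb (F : finFieldType) (L : fieldExtType {fraction {poly F}})
    (a : F) : L := (tofrac a%:P)%:A.

(* B is the integral closure of F[s] in L, a finite separable extension of
   F(t) = [{fraction {poly F}}]; as s is any element of L transcendental over F,
   it may differ from this t, and L need not be separable over F(s). *)
Definition is_function_field_integers (B : comNzRingType) : Prop :=
  exists (F : finFieldType) (L : fieldExtType {fraction {poly F}})
         (s : L) (iota : {rmorphism B -> L}),
    [/\ separable 1 {:L},
        ~ algebraicOver (@const_emb F L) s
      & is_integral_closure
          (fun p : {poly F} => (map_poly (@const_emb F L) p).[s]) iota].

Definition is_global_field_integers (B : comNzRingType) : Prop :=
  is_number_field_integers B \/ is_function_field_integers B.

(* Main.v *)
Require Import Defs.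
From HB Require Import structures.
From mathcomp Require Import all_boot all_algebra all_field.
From mathcomp Require Import finmap boolp classical_sets cardinality.
From mathcomp Require Import ring zify.

(** A norm satisfying the quasi-triangle inequality already allows division
    with a small remainder, and this makes [A] finitely generated over a very
    small ring.  Let [q] be a nonzero nonunit of [A]; a power of it has norm
    greater than any given bound.  Two elements of norm at most [n] that are
    congruent modulo such a power differ by a multiple of it whose norm is too
    small, so they are equal: there are only finitely many elements of bounded
    norm ([ideal_norm_bounded_finite]).  Writing [x = r + q * z] with [r] in a
    finite set of representatives modulo [q], the quasi-triangle inequality
    gives [N z < N x] as soon as [N x] exceeds a constant and [N q] is large.
    Descending along the norm, every [x] is a combination, with coefficients
    in the subring generated by [q], of the finitely many representatives and
    the finitely many elements of small norm ([quasi_triangle_spans]).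

    In characteristic 0 the element [q] can be taken in the image of the
    integers, so [A], and hence [B], is finitely generated over [int].  In
    characteristic [p] the element [q] is transcendental over ['F_p], so [B] is
    finitely generated over a polynomial ring ['F_p[q]].  In both cases the
    fraction field [L] of [B] is a finite extension of the fraction field of
    the base ring, and every element of [B] is integral over the base ring.
    Conversely, [B] is integrally closed because ideals factor uniquely: for
    [x] in [L] integral over [B] and a common denominator [d] of [B[x]], the
    ideal [I = d B[x]] satisfies [I * I = d * I], whence [I = (d)] and [x] lies
    in [B] ([Dedekind_integrally_closed]).  So [B] is the integral closure of
    the base ring in [L] ([integral_closure_in_fieldExt]).

    In characteristic [p] the extension must also be made separable.  If [q] is
    the [p]-th power of some [y] in [B], then [B] is finitely generated over
    ['F_p[y]] as well, and [y] replaces [q].  This can happen only finitely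
    often: by Cayley-Hamilton an element of a module with [n] generators is a
    root of a monic polynomial of degree [n], and this bounds the exponent of
    the power by [n] ([exists_non_power_generator]).  Once [q] is not a [p]-th
    power, [L] is separable over ['F_p(q)] because [1, q, ..., q ^ (p - 1)] are
    independent over the subfield of [p]-th powers
    ([separable_of_non_power]). *)

Set Implicit Arguments.
Unset Strict Implicit.
Unset Printing Implicit Defensive.

Import GRing.Theory Pdiv.Ring Pdiv.RingMonic.
Local Open Scope classical_set_scope.
Local Open Scope ring_scope.

(** * Ideal norms *)

Section IdealNorm.
Variable A : idomainType.
Implicit Types (a b x y : A) (s : seq A).

Definition transversal a s : Prop :=
  [/\ uniq s,
      forall x, exists2 r, r \in s & exists z, x = r + a * z
    & forall r r' z, r \in s -> r' \in s -> r = r' + a * z -> r = r'].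

Lemma transversal_leq a s s' :
  transversal a s -> transversal a s' -> (size s <= size s')%N.
Proof.
move=> [us _ inj_s] [_ cov_s' _].
have /choice[g gP] x : exists r, r \in s' /\ exists z, x = r + a * z.
  by have [r rs' xr] := cov_s' x; exists r.
rewrite -(size_map g); apply: uniq_leq_size; last first.
  by move=> _ /mapP[x _ ->]; case: (gP x).
rewrite map_inj_in_uniq // => x y xs ys gxy.
have [_ [z xE]] := gP x; have [_ [w yE]] := gP y.
apply: (inj_s _ _ (z - w)) => //.
have azE : a * z = x - g x by apply/esym/eqP; rewrite subr_eq addrC -xE.
have awE : a * w = y - g y by apply/esym/eqP; rewrite subr_eq addrC -yE.
by rewrite mulrBr azE awE gxy; ring.
Qed.

Lemma is_ideal_principal a : is_ideal (principal_ideal a).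
Proof.
split; first by exists 0; rewrite // mulr0.
  by move=> _ _ [x _ <-] [y _ <-]; exists (x + y); rewrite // mulrDr.
by move=> b _ [x _ <-]; exists (b * x); rewrite // mulrCA.
Qed.

Hypothesis finA : finite_quotients A.

(** Counting through representatives avoids quotient rings: the norm becomes the
    length of a list. *)
Lemma transversal_ideal_norm a :
  a != 0 -> exists2 s, transversal a s & size s = ideal_norm a.
Proof.
move=> a0; have finI : finite_set (cosets (principal_ideal a)).
  apply: finA; first exact: is_ideal_principal.
  move=> aE; have : principal_ideal a a by exists 1; rewrite // mulr1.
  by rewrite aE => /= /eqP; rewrite (negPf a0).
rewrite /ideal_norm (negPf a0).
set F := fset_set _; pose rep (P : set A) := xget 0 P.
have memF P : (P \in F) = (P \in cosets (principal_ideal a)) by rewrite in_fset_set.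
have repP x : exists z, x = rep [set b | principal_ideal a (b - x)] + a * z.
  rewrite /rep; case: xgetP => [r -> [z _ zE]|/(_ x)]; last first.
    by case; exists 0; rewrite // mulr0 subrr.
  by exists (- z); rewrite mulrN zE opprB addrC subrK.
have cosetE x y z : x = y + a * z ->
    [set b | principal_ideal a (b - x)] = [set b | principal_ideal a (b - y)].
  move=> ->; apply/seteqP; split=> b [w _ wE].
    by exists (w + z) => //; rewrite mulrDr wE opprD addrA subrK.
  by exists (w - z) => //; rewrite mulrBr wE opprD addrA.
exists [seq rep P | P <- F]; last by rewrite size_map.
split.
- rewrite map_inj_in_uniq ?fset_uniq // => P Q.
  rewrite !memF !inE => -[x _ <-] [y _ <-] repE.
  have [z xE] := repP x; have [w yE] := repP y.
  by rewrite (cosetE _ _ _ xE) repE -(cosetE _ _ _ yE).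
- move=> x; exists (rep [set b | principal_ideal a (b - x)]); last exact: repP.
  by apply: map_f; rewrite memF inE; exists x.
- move=> r r' z /mapP[P + ->] /mapP[Q + ->].
  rewrite !memF !inE => -[x _ <-] [y _ <-] /cosetE E; congr (rep _).
  have [u xE] := repP x; have [v yE] := repP y.
  by rewrite (cosetE _ _ _ xE) E -(cosetE _ _ _ yE).
Qed.

Lemma ideal_norm_transversal a s :
  a != 0 -> transversal a s -> ideal_norm a = size s.
Proof.
move=> /transversal_ideal_norm[s' ts' <-] ts.
by apply/eqP; rewrite eqn_leq (transversal_leq ts' ts) (transversal_leq ts ts').
Qed.

(** If [r] runs over representatives modulo [a] and [t] over representatives
    modulo [b], then [r + a * t] runs over representatives modulo [a * b]. *)
Lemma ideal_normM a b : ideal_norm (a * b) = (ideal_norm a * ideal_norm b)%N.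
Proof.
have [->|a0] := eqVneq a 0; first by rewrite mul0r /ideal_norm eqxx.
have [->|b0] := eqVneq b 0; first by rewrite mulr0 /ideal_norm eqxx muln0.
have [s ts <-] := transversal_ideal_norm a0.
have [u tu <-] := transversal_ideal_norm b0.
rewrite -(size_allpairs (fun x y => x + a * y)).
apply: ideal_norm_transversal; rewrite ?mulf_neq0 //.
have [us cov_s inj_s] := ts; have [uu cov_u inj_u] := tu.
split.
- apply: allpairs_uniq => // _ _ /allpairsP[[x y] [/= xs yu ->]]
    /allpairsP[[x' y'] [/= xs' yu' ->]] /= E.
  have xx' : x = x'.
    apply: (inj_s _ _ (y' - y)) => //.
    by rewrite mulrBr addrA -E addrK.
  by move: E; rewrite xx' => /addrI /(mulfI a0) ->.
- move=> x; have [r rs [z ->]] := cov_s x; have [t tu' [w ->]] := cov_u z.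
  exists (r + a * t); first exact: (allpairs_f (fun x y => x + a * y)).
  by exists w; rewrite mulrDr mulrA addrA.
- move=> _ _ z /allpairsP[[x y] [/= xs yu ->]] /allpairsP[[x' y'] [/= xs' yu' ->]] E.
  have xx' : x = x'.
    apply: (inj_s _ _ (y' + b * z - y)) => //.
    by rewrite mulrBr mulrDr addrA mulrA addrA -E addrK.
  congr (_ + a * _) => //; apply: (inj_u _ _ z) => //; apply: (mulfI a0).
  by move: E; rewrite xx' -addrA => /addrI ->; rewrite mulrDr mulrA.
Qed.

Lemma ideal_normN a : ideal_norm (- a) = ideal_norm a.
Proof.
rewrite /ideal_norm oppr_eq0; suff -> : principal_ideal (- a) = principal_ideal a by [].
apply/seteqP; split=> _ [x _ <-]; exists (- x) => //; first by rewrite mulrN mulNr.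
by rewrite mulrNN.
Qed.

Lemma ideal_norm_gt0 a : a != 0 -> (0 < ideal_norm a)%N.
Proof.
move=> a0; have [s [_ cov _] <-] := transversal_ideal_norm a0.
by have [r rs _] := cov 0; case: s rs {cov}.
Qed.

(** The cosets of 0 and 1 differ. *)
Lemma ideal_norm_nonunit a :
  a != 0 -> (forall b, a * b != 1) -> (1 < ideal_norm a)%N.
Proof.
move=> a0 aU; have [s [_ cov _] <-] := transversal_ideal_norm a0.
have [r rs [z rE]] := cov 0; have [r' rs' [z' r'E]] := cov 1.
case: s rs rs' {cov} => [|x [|y s]] //; rewrite !inE => /eqP rx /eqP r'x.
have /negP[] := aU (z' - z); apply/eqP.
by rewrite mulrBr -[RHS]subr0 {1}rE {1}r'E rx r'x; ring.
Qed.

End IdealNorm.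

(** * Unique factorization of ideals and integral closedness *)

Lemma fraction_quot (D : idomainType) (x : {fraction D}) :
  exists a b : D, b != 0 /\ x = tofrac a / tofrac b.
Proof.
elim/quotW: x => r; exists (frac r).1, (frac r).2.
have r0 := denom_ratioP r; split=> //.
apply: (canRL (mulfK _)); first by rewrite tofrac_eq0.
unlock FracField.tofrac; rewrite -[LHS]FracField.pi_mul.
apply/eqP; rewrite FracField.equivf_def /FracField.mulf.
by rewrite !numden_Ratio ?mulf_neq0 ?oner_eq0 //; apply/eqP; ring.
Qed.

Section IdealProducts.
Variable R : comNzRingType.
Implicit Types I J K : set R.

Lemma mem_ideal_mul I J x y : I x -> J y -> ideal_mul I J (x * y).
Proof.
move=> Ix Jy; exists [:: (x, y)]; split; last by rewrite big_seq1.
by move=> p; rewrite inE => /eqP ->.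
Qed.

Lemma ideal_mulD I J x y :
  ideal_mul I J x -> ideal_mul I J y -> ideal_mul I J (x + y).
Proof.
move=> [s [sIJ ->]] [t [tIJ ->]]; exists (s ++ t); split; last by rewrite big_cat.
by move=> p; rewrite mem_cat => /orP[/sIJ|/tIJ].
Qed.

Lemma ideal_mul0 I J : ideal_mul I J 0.
Proof. by exists [::]; split=> //; rewrite big_nil. Qed.

Lemma ideal_mul_sub I J (K : set R) :
  K 0 -> (forall x y, K x -> K y -> K (x + y)) ->
  (forall x y, I x -> J y -> K (x * y)) -> ideal_mul I J `<=` K.
Proof.
move=> K0 KD KM _ [s [sIJ ->]].
rewrite big_seq; apply: big_ind => // p /sIJ[]; exact: KM.
Qed.

Lemma is_ideal_mul I J : is_ideal J -> is_ideal (ideal_mul I J).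
Proof.
move=> [J0 JD JM]; split; [exact: ideal_mul0|exact: ideal_mulD|].
move=> a x; move: x; apply: ideal_mul_sub; first by rewrite mulr0; exact: ideal_mul0.
  by move=> x y; rewrite mulrDr; exact: ideal_mulD.
by move=> x y Ix Jy; rewrite mulrCA; apply: mem_ideal_mul => //; apply: JM.
Qed.

Lemma ideal_mulCA I J K :
  ideal_mul I (ideal_mul J K) = ideal_mul J (ideal_mul I K).
Proof.
have sub I' J' : ideal_mul I' (ideal_mul J' K) `<=` ideal_mul J' (ideal_mul I' K).
  apply: ideal_mul_sub; [exact: ideal_mul0|exact: ideal_mulD|].
  move=> x y Ix; move: y; apply: ideal_mul_sub; first by rewrite mulr0; exact: ideal_mul0.
    by move=> y z; rewrite mulrDr; exact: ideal_mulD.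
  by move=> y z Jy Kz; rewrite mulrCA; do 2?apply: mem_ideal_mul.
by apply/seteqP; split; exact: sub.
Qed.

Lemma ideal_mulC I J : ideal_mul I J = ideal_mul J I.
Proof.
have sub I' J' : ideal_mul I' J' `<=` ideal_mul J' I'.
  apply: ideal_mul_sub; [exact: ideal_mul0|exact: ideal_mulD|].
  by move=> x y Ix Jy; rewrite mulrC; apply: mem_ideal_mul.
by apply/seteqP; split; exact: sub.
Qed.

Lemma ideal_mulA I J K : ideal_mul I (ideal_mul J K) = ideal_mul (ideal_mul I J) K.
Proof. by rewrite [ideal_mul J K]ideal_mulC ideal_mulCA ideal_mulC. Qed.

Lemma ideal_mulTl J : is_ideal J -> ideal_mul setT J = J.
Proof.
move=> [J0 JD JM]; apply/seteqP; split=> [|x Jx].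
  by apply: ideal_mul_sub => // x y _; exact: JM.
by rewrite -[x]mul1r; apply: mem_ideal_mul.
Qed.

Lemma is_ideal_setT : is_ideal (setT : set R).
Proof. by []. Qed.

Lemma is_ideal_prod s : is_ideal (ideal_prod s : set R).
Proof. by elim: s => [|I s IHs]; [exact: is_ideal_setT|exact: is_ideal_mul]. Qed.

Lemma ideal_prod_cat (s t : seq (set R)) :
  ideal_prod (s ++ t) = ideal_mul (ideal_prod s) (ideal_prod t).
Proof.
elim: s => [|I s IHs] /=; first by rewrite ideal_mulTl //; exact: is_ideal_prod.
by rewrite -ideal_mulA -IHs.
Qed.

Lemma ideal_prod_perm (s t : seq (set R)) : perm_eq s t -> ideal_prod s = ideal_prod t.
Proof.
elim: s t => [|I s IHs] t st; first by move: st; rewrite perm_sym => /perm_nilP ->.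
have It : I \in t by rewrite -(perm_mem st) mem_head.
move: st; case/splitPr: It => t1 t2 st.
have /IHs IH : perm_eq s (t1 ++ t2).
  by rewrite -(perm_cons I) (perm_trans st) // -cat1s perm_catCA.
by rewrite /= IH !ideal_prod_cat /= ideal_mulCA.
Qed.

End IdealProducts.

Section Dedekind.
Variable D : idomainType.
Hypothesis dedD : is_Dedekind_domain D.
Implicit Types I J : set D.

Lemma exists_prime_factorization I :
  is_ideal I -> I <> [set 0] -> exists s, prime_factorization I s.
Proof.
move=> idI I0; have [->|IT] := pselect (I = setT); first by exists [::].
by have [s sI _] := dedD.2 I idI I0 IT; exists s.
Qed.

Lemma prime_factorization_mul I J s t :
  prime_factorization I s -> prime_factorization J t ->
  prime_factorization (ideal_mul I J) (s ++ t).
Proof.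
move=> [sP ->] [tP ->]; split; last by rewrite ideal_prod_cat.
by move=> P; rewrite mem_cat => /orP[/sP|/tP].
Qed.

(** Comparing the factorizations [s ++ s] and [t ++ s] of one ideal gives that [s]
    and [t] agree up to order. *)
Lemma ideal_mul_cancel I J : is_ideal I -> is_ideal J ->
  I <> [set 0] -> J <> [set 0] -> ideal_mul I I = ideal_mul J I -> I = J.
Proof.
move=> idI idJ I0 J0 IIJI.
have [s sI] := exists_prime_factorization idI I0.
have [t tJ] := exists_prime_factorization idJ J0.
have [IIT|IIT] := pselect (ideal_mul I I = setT).
  have -> : I = setT.
    apply/seteqP; split=> // x _; have : ideal_mul I I x by rewrite IIT.
    by have [i0 iD iM] := idI; apply: ideal_mul_sub => // y z _; exact: iM.
  apply/esym/seteqP; split=> // x _; have : ideal_mul I J x.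
    by rewrite ideal_mulC -IIJI IIT.
  by have [j0 jD jM] := idJ; apply: ideal_mul_sub => // y z _; exact: jM.
have II0 : ideal_mul I I <> [set 0].
  move=> II0; apply: I0; apply/seteqP; split=> [x Ix|_ ->]; last by case: idI.
  have : ideal_mul I I (x * x) by exact: mem_ideal_mul.
  by rewrite II0 => /= /eqP; rewrite mulf_eq0 orbb => /eqP.
have [u _ uniq_u] := dedD.2 _ (is_ideal_mul I idI) II0 IIT.
have /uniq_u us := prime_factorization_mul sI sI.
have := prime_factorization_mul tJ sI; rewrite -IIJI => /uniq_u.
rewrite (permPl us) perm_cat2r => st.
by rewrite sI.2 tJ.2; exact: ideal_prod_perm.
Qed.

(** With [P] monic of degree [m] vanishing at [x = a / b], the element [d = b ^ m] is a
    common denominator of [D[x]].  Since [D[x]] is a ring, the ideal [I = d D[x]] satisfies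
    [I * I = d * I]; cancelling [I] gives [d D[x] = d D]. *)
Lemma Dedekind_integrally_closed (x : {fraction D}) :
  integralOver (@tofrac D) x -> exists d, x = tofrac d.
Proof.
move=> [P Pm Px].
have [a [b [b0 xE]]] := fraction_quot x.
have b0' : tofrac b != 0 by rewrite tofrac_eq0.
pose m := (size P).-1; pose d := b ^+ m.
have d0 : d != 0 by rewrite expf_neq0.
have d0' : tofrac d != 0 by rewrite tofrac_eq0.
(* [ev] parametrizes the elements of [D[x]]. *)
pose ev (q : {poly D}) := (map_poly (@tofrac D) q).[x].
have evM q r : ev (q * r) = ev q * ev r by rewrite /ev rmorphM hornerM.
have dev q : exists z, tofrac d * ev q = tofrac z.
  have -> : ev q = ev (rmodp q P).
    rewrite /ev {1}(rdivp_eq Pm q) rmorphD rmorphM /= hornerD hornerM.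
    by rewrite (rootP Px) mulr0 add0r.
  have : (size (rmodp q P) <= m)%N.
    by rewrite -ltnS prednK ?ltn_rmodp ?size_poly_gt0 monic_neq0.
  move: (rmodp q P) => r rm.
  exists (\sum_(i < size r) r`_i * a ^+ i * b ^+ (m - i)).
  rewrite rmorph_sum /ev horner_poly mulr_sumr; apply: eq_bigr => i _.
  have im : (i <= m)%N by rewrite (leq_trans _ rm) // ltnW.
  rewrite !rmorphM !rmorphXn /= -{1}(subnK im) exprD xE expr_div_n.
  have cancel (F : fieldType) (u v w y : F) : y != 0 -> u * y * (v * (w / y)) = v * w * u.
    by move=> y0; field.
  by rewrite cancel ?expf_neq0.
pose I : set D := [set z | exists q, tofrac z = tofrac d * ev q].
have idI : is_ideal I.
  split.
  - by exists 0; rewrite /ev !rmorph0 horner0 mulr0.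
  - move=> y z [q yE] [r zE]; exists (q + r).
    by rewrite rmorphD /= yE zE /ev rmorphD hornerD mulrDr.
  - move=> y z [q zE]; exists (y%:P * q).
    by rewrite rmorphM /= zE evM /ev map_polyC hornerC mulrCA.
have Id : I d by exists 1; rewrite /ev rmorph1 hornerC mulr1.
have IJ : I = principal_ideal d.
  have nz (K : set D) : K d -> K <> [set 0].
    by move=> Kd K0; move: Kd; rewrite K0 => /eqP; apply/negP.
  have Jd : principal_ideal d d by exists 1; rewrite // mulr1.
  apply: ideal_mul_cancel => //; [exact: is_ideal_principal|exact: nz|exact: nz|].
  apply/seteqP; split.
    apply: ideal_mul_sub; [exact: ideal_mul0|exact: ideal_mulD|].
    move=> y z [q yE] [r zE]; have [w wE] := dev (q * r).
    have -> : y * z = d * w.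
      by apply/eqP; rewrite -tofrac_eq !rmorphM /= -wE yE zE evM; apply/eqP; ring.
    apply: mem_ideal_mul; first by exists 1; rewrite // mulr1.
    by exists (q * r).
  apply: ideal_mul_sub; [exact: ideal_mul0|exact: ideal_mulD|].
  move=> _ z [r _ <-] Iz; rewrite -mulrA; apply: mem_ideal_mul => //.
  by have [_ _] := idI; apply.
(* [d * x] lies in [I], hence is a multiple of [d]. *)
have [z zE] := dev 'X; have : I z by exists 'X.
rewrite IJ => -[w _ dw]; exists w; apply: (mulfI d0').
by rewrite -rmorphM /= dw -zE /ev map_polyX hornerX.
Qed.

End Dedekind.

(** * Finitely generated modules and integrality *)

(** [e] generates [S] as a module over [R] along [f]; an arbitrary finite index type
    makes products of families immediate. *)
Definition spans (R S : nzRingType) (f : R -> S) (I : finType) (e : I -> S) :=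
  forall x, exists c : I -> R, x = \sum_i f (c i) * e i.

Lemma spans_trans (R S T : nzRingType) (f : R -> S) (g : {rmorphism S -> T})
    (I J : finType) (e : I -> S) (e' : J -> T) :
  spans f e -> spans g e' -> spans (g \o f) (fun k => g (e k.1) * e' k.2).
Proof.
move=> sf sg x; have [c ->] := sg x.
have /choice[d dP] j := sf (c j).
exists (fun k => d k.2 k.1).
rewrite -(pair_bigA _ (fun i j => (g \o f) (d j i) * (g (e i) * e' j))) /=.
rewrite exchange_big; apply: eq_bigr => j _.
rewrite {1}dP rmorph_sum mulr_suml; apply: eq_bigr => i _.
by rewrite rmorphM mulrA.
Qed.

(** Cayley-Hamilton: [x] is an eigenvalue of the matrix of multiplication by [x]
    on the generators.  The exact degree is what bounds [p]-th roots in
    [spans_Frobenius_bound]. *)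
Lemma spans_root_monic (R : comNzRingType) (D : idomainType)
    (f : {rmorphism R -> D}) (I : finType) (e : I -> D) (x : D) :
  spans f e ->
  exists P : {poly R}, [/\ P \is monic, size P = #|I|.+1 & root (map_poly f P) x].
Proof.
move=> se; have /choice[c cE] (k : 'I_#|I|) := se (e (enum_val k) * x).
pose A : 'M[R]_#|I| := \matrix_(i, k) c k (enum_val i).
exists (char_poly A); split; [exact: char_poly_monic|exact: size_char_poly|].
pose g : {rmorphism R -> {fraction D}} := (@tofrac D) \o f.
suff : root (map_poly g (char_poly A)) (tofrac x).
  by rewrite map_poly_comp /= /root horner_map /= tofrac_eq0.
rewrite map_char_poly -eigenvalue_root_char.
apply/eigenvalueP; exists (\row_k tofrac (e (enum_val k))).
  apply/rowP => k; rewrite !mxE -rmorphM mulrC cE.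
  rewrite rmorph_sum [RHS](reindex (@enum_val I predT)) /=; last first.
    exact/onW_bij/enum_val_bij.
  by apply: eq_bigr => i _; rewrite !mxE rmorphM mulrC.
apply/negP => /eqP/rowP v0; have [d] := se 1.
rewrite big1 => [/eqP|i _]; first by rewrite oner_eq0.
have := v0 (enum_rank i); rewrite !mxE enum_rankK => /eqP.
by rewrite tofrac_eq0 => /eqP ->; rewrite mulr0.
Qed.

(** Divide [P] by ['X] until the constant coefficient [c] is nonzero; then [x] divides
    [c]. *)
Lemma dvd_scalar_of_root (R : nzRingType) (D : idomainType) (f : {rmorphism R -> D})
    (P : {poly R}) (x : D) :
  P != 0 -> root (map_poly f P) x -> x != 0 ->
  exists y c, c != 0 /\ x * y = f c.
Proof.
move=> + + x0; elim/poly_ind: P => [|P c IHP]; first by rewrite eqxx.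
have [->|c0] := eqVneq c 0; last first.
  move=> _ /rootP; rewrite rmorphD rmorphM /= map_polyX map_polyC /= hornerD.
  rewrite hornerMX hornerC => /eqP; rewrite addr_eq0 => /eqP E.
  by exists (map_poly f P).[x], (- c); rewrite oppr_eq0 rmorphN mulrC E.
rewrite addr0 => P0; rewrite rmorphM /= map_polyX rootM rootX (negPf x0) orbF.
by apply: IHP; apply: contraNneq P0 => ->; rewrite mul0r.
Qed.

(** * Finite generation from the quasi-triangle inequality *)

Section NormedDomain.
Variable A : idomainType.
Hypotheses (finA : finite_quotients A) (triA : quasi_triangle A).

Lemma ideal_normX_gt (a : A) k :
  a != 0 -> (forall b, a * b != 1) -> (k < ideal_norm (a ^+ k.+1))%N.
Proof.
move=> a0 aU; have a_gt1 := ideal_norm_nonunit finA a0 aU.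
elim: k => [|k IHk]; first by rewrite expr1 ltnW.
rewrite exprS ideal_normM // (leq_trans _ (leq_mul a_gt1 IHk)) //; lia.
Qed.

(** Modulo a power of [a] of norm larger than [C * (n + n)], each coset contains
    at most one element of norm at most [n]. *)
Lemma ideal_norm_bounded_finite (a : A) n :
  a != 0 -> (forall b, a * b != 1) ->
  exists l : seq A, forall x, (ideal_norm x <= n)%N -> x \in l.
Proof.
move=> a0 aU; have [C [C0 triC]] := triA.
pose b := a ^+ (C * (n + n)).+1.
have b0 : b != 0 by rewrite expf_neq0.
have b_gt : (C * (n + n) < ideal_norm b)%N by exact: ideal_normX_gt.
have [s [_ cov _] _] := transversal_ideal_norm finA b0.
(* [g r] is the element of norm at most [n] in the coset of [r], if there is one. *)
have /choice[g gP] r : exists y, forall x z, (ideal_norm x <= n)%N -> x = r + b * z ->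
    (ideal_norm y <= n)%N /\ exists w, y = r + b * w.
  have [[x [z [xn xE]]]|none] :=
      pselect (exists x z, (ideal_norm x <= n)%N /\ x = r + b * z).
    by exists x => _ _ _ _; split=> //; exists z.
  by exists 0 => x z xn xE; case: none; exists x, z.
exists [seq g r | r <- s] => x xn; have [r rs [z xE]] := cov x.
have [gn [w gE]] := gP r x z xn xE; apply/mapP; exists r => //.
have zw : x + (- g r) = b * (z - w) by rewrite {1}xE gE; ring.
apply/eqP; rewrite -subr_eq0 zw; apply: contraTT b_gt => nz.
rewrite -leqNgt (leq_trans _ (leq_trans (triC x (- g r)) _)) //.
  rewrite zw ideal_normM // leq_pmulr // ideal_norm_gt0 //.
  by apply: contraNneq nz => ->; rewrite mulr0.
by rewrite leq_mul2l leq_add ?orbT // ideal_normN.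
Qed.

(** Descent on the norm: with [N q > 2 * C], an element [x] of norm larger than all
    remainders is [e + q * z] with [N z < N x].  The generators are the remainders
    together with the elements whose norm is at most the largest remainder norm. *)
Lemma quasi_triangle_spans (R : nzRingType) (f : {rmorphism R -> A}) (r : R) :
  f r != 0 -> (forall b, f r * b != 1) ->
  exists (I : finType) (e : I -> A), spans f e.
Proof.
move=> r0 rU; have [C [C0 triC]] := triA.
pose q := r ^+ (C.*2).+1.
have q0 : f q != 0 by rewrite rmorphXn expf_neq0.
have q_gt : (C.*2 < ideal_norm (f q))%N by rewrite rmorphXn ideal_normX_gt.
have [s [_ cov _] _] := transversal_ideal_norm finA q0.
pose E := \max_(x <- s) ideal_norm x.
have sE x : x \in s -> (ideal_norm x <= E)%N by move=> xs; apply: leq_bigmax_seq.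
have [l lE] := ideal_norm_bounded_finite E r0 rU.
pose t := s ++ l; exists ('I_(size t)), (fun i : 'I_(size t) => t`_i).
pose M x := exists c : 'I_(size t) -> R, x = \sum_i f (c i) * t`_i.
have tM x : x \in t -> M x.
  move=> xt; exists (fun i => (nat_of_ord i == index x t)%:R).
  have ix : (index x t < size t)%N by rewrite index_mem.
  rewrite (bigD1 (Ordinal ix)) //= eqxx rmorph1 mul1r nth_index // big1 ?addr0 //.
  by move=> i; rewrite -val_eqE /= => /negPf->; rewrite rmorph0 mul0r.
have MD x y : M x -> M y -> M (x + y).
  move=> [c ->] [d ->]; exists (fun i => c i + d i); rewrite -big_split.
  by apply: eq_bigr => i _; rewrite rmorphD mulrDl.
have MZ x y : M x -> M (f y * x).
  move=> [c ->]; exists (fun i => y * c i); rewrite mulr_sumr.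
  by apply: eq_bigr => i _; rewrite rmorphM mulrA.
move=> x; change (M x); have [n] := ubnP (ideal_norm x).
elim: n x => // n IHn x; rewrite ltnS => xn.
have [xE|Ex] := leqP (ideal_norm x) E; first by apply: tM; rewrite mem_cat lE ?orbT.
have [e es [z xez]] := cov x; rewrite xez; apply: MD.
  by apply: tM; rewrite mem_cat es.
apply/MZ/IHn.
have := triC x (- e); rewrite ideal_normN {1}xez addrAC subrr add0r ideal_normM //.
have := sE _ es; nia.
Qed.

End NormedDomain.

(** * Finite field extensions along a morphism *)

Section ExtensionAlongMorphism.
Variables (K E : fieldType) (j : {rmorphism K -> E}).

(** A copy of [E] that carries the [K]-algebra structure given by [j]. *)
Definition ext_along of {rmorphism K -> E} : Type := E.
Local Notation L := (ext_along j).

HB.instance Definition _ := GRing.Field.on L.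

Definition ext_scale (a : K) (x : L) : L := j a * x.

Fact ext_scaleA a b x : ext_scale a (ext_scale b x) = ext_scale (a * b) x.
Proof. by rewrite /ext_scale rmorphM mulrA. Qed.

Fact ext_scale1 : left_id 1 ext_scale.
Proof. by move=> x; rewrite /ext_scale rmorph1 mul1r. Qed.

Fact ext_scaleDr : right_distributive ext_scale +%R.
Proof. by move=> a x y; apply: mulrDr. Qed.

Fact ext_scaleDl x : {morph ext_scale^~ x : a b / a + b}.
Proof. by move=> a b; rewrite /ext_scale rmorphD mulrDl. Qed.

HB.instance Definition _ := GRing.Zmodule_isLmodule.Build K L
  ext_scaleA ext_scale1 ext_scaleDr ext_scaleDl.

Fact ext_scaleAl (a : K) (x y : L) : a *: (x * y) = a *: x * y.
Proof. exact: mulrA. Qed.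

HB.instance Definition _ := GRing.Lmodule_isLalgebra.Build K L ext_scaleAl.

Fact ext_scaleAr (a : K) (x y : L) : a *: (x * y) = x * (a *: y).
Proof. exact: mulrCA. Qed.

HB.instance Definition _ := GRing.Lalgebra_isAlgebra.Build K L ext_scaleAr.

Lemma spans_basis n (e : 'I_n -> E) : spans j e ->
  exists m (b : 'I_m -> E), spans j b /\
    forall c : 'I_m -> K, \sum_i j (c i) * b i = 0 -> forall i, c i = 0.
Proof.
elim: n e => [|n IHn] e se; first by exists 0, e; split=> // c _ [].
have [[c [ce [k ck]]]|free_e] :=
    pselect (exists c, \sum_i j (c i) * e i = 0 /\ exists k, c k != 0); last first.
  exists n.+1, e; split=> // c ce i; apply/eqP/negPn/negP => ci.
  by apply: free_e; exists c; split=> //; exists i.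
apply: (IHn (e \o lift k)) => x; have [d ->] := se x.
exists (fun i => d (lift k i) - d k * (c k)^-1 * c (lift k i)).
have jck : j (c k) != 0 by rewrite fmorph_eq0.
have ek : e k = - (j (c k))^-1 * \sum_i j (c (lift k i)) * e (lift k i).
  apply: (mulfI jck); rewrite mulrA mulrN divff // mulN1r; apply/eqP.
  by rewrite -addr_eq0 -[X in _ == X]ce (bigD1_ord k).
rewrite (bigD1_ord k) //= ek mulrA mulr_sumr -big_split; apply: eq_bigr => i _ /=.
by rewrite rmorphB !rmorphM fmorphV /=; ring.
Qed.

Lemma spans_fieldExt n (e : 'I_n -> E) : spans j e ->
  exists (M : fieldExtType K) (phi : {rmorphism E -> M}),
    bijective phi /\ forall a, phi (j a) = a%:A.
Proof.
move=> /spans_basis[m [b [sb free_b]]].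
pose r2v (v : 'rV[K]_m) : L := \sum_i v 0 i *: (b i : L).
have r2v_lin : linear r2v.
  move=> a u v; rewrite /r2v scaler_sumr -big_split /=; apply: eq_bigr => i _.
  by rewrite scalerA -scalerDl !mxE.
have r2v_inj : injective r2v.
  move=> u v uv; apply/rowP => i; apply/eqP; rewrite -subr_eq0; apply/eqP.
  apply: (free_b (fun i => u 0 i - v 0 i)).
  rewrite (eq_bigr (fun i => u 0 i *: (b i : L) - v 0 i *: (b i : L))).
    by rewrite sumrB -/(r2v u) -/(r2v v) uv subrr.
  by move=> k _; rewrite -scalerBl.
have /choice[v2r v2rK] (x : L) : exists r, r2v r = x.
  by have [c ->] := sb x; exists (\row_i c i); apply: eq_bigr => i _; rewrite mxE.
have finL : Lmodule_hasFinDim K L.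
  exists m, v2r; last by exists r2v => // r; apply: r2v_inj.
  by move=> a x y; apply: r2v_inj; rewrite r2v_lin !v2rK.
pose M : fieldExtType K := HB.pack L finL.
exists M, (idfun : {rmorphism E -> E}); split; first by exists id.
by move=> a; rewrite -[RHS]/(j a * 1) mulr1.
Qed.

End ExtensionAlongMorphism.

Section FractionField.
Variables (R : idomainType) (K : fieldType) (i : {rmorphism R -> K}).
Hypotheses (i_inj : injective i)
  (i_quot : forall k, exists a b, b != 0 /\ k = i a / i b).

(** Universal property of [K], known only through [i_quot]: this covers both [rat]
    over [int] and [{fraction R}] over [R]. *)
Lemma fraction_lift (F : fieldType) (g : {rmorphism R -> F}) :
  injective g -> exists j : {rmorphism K -> F}, forall r, j (i r) = g r.
Proof.
move=> g_inj.
have i0 r : (i r == 0) = (r == 0) by rewrite raddf_eq0.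
have g0 r : (g r == 0) = (r == 0) by rewrite raddf_eq0.
have /choice[j jP] k : exists y, forall a b, b != 0 -> k = i a / i b -> y = g a / g b.
  have [a [b [b0 kE]]] := i_quot k; exists (g a / g b) => c d d0 kE'.
  apply/eqP; rewrite eqr_div ?g0 // -!rmorphM (inj_eq g_inj) -(inj_eq i_inj) !rmorphM.
  by rewrite -eqr_div ?i0 // -kE -kE'.
have jE a b : b != 0 -> j (i a / i b) = g a / g b by move=> b0; exact: jP.
have j_add : zmod_morphism j.
  move=> x y; have [a [b [b0 ->]]] := i_quot x; have [c [d [d0 ->]]] := i_quot y.
  have -> : i a / i b - i c / i d = i (a * d - c * b) / i (b * d).
    by rewrite rmorphB !rmorphM /=; field; rewrite !i0 b0 d0.
  rewrite !jE ?mulf_neq0 // rmorphB !rmorphM /=.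
  by field; rewrite !g0 b0 d0.
have j_mul : monoid_morphism j.
  split; first by rewrite -(divr1 1) -(rmorph1 i) jE ?oner_eq0 // rmorph1 divr1.
  move=> x y; have [a [b [b0 ->]]] := i_quot x; have [c [d [d0 ->]]] := i_quot y.
  have -> : (i a / i b) * (i c / i d) = i (a * c) / i (b * d).
    by rewrite !rmorphM /=; field; rewrite !i0 b0 d0.
  rewrite !jE ?mulf_neq0 // !rmorphM /=.
  by field; rewrite !g0 b0 d0.
pose jA := GRing.isZmodMorphism.Build _ _ j j_add.
pose jM := GRing.isMonoidMorphism.Build _ _ j j_mul.
exists (HB.pack j jA jM : {rmorphism K -> F}) => r /=.
by rewrite -[i r]divr1 -(rmorph1 i) jE ?oner_eq0 // rmorph1 divr1.
Qed.

(** Every nonzero element of [D] divides a scalar, so a fraction over [D] has the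
    form [d / f c]; hence generators of [D] over [R] span the fraction field of [D] over
    [K]. *)
Lemma integral_closure_in_fieldExt (D : idomainType) (f : {rmorphism R -> D})
    (I : finType) (e : I -> D) :
  injective f -> spans f e ->
  (forall x : {fraction D}, integralOver (@tofrac D) x -> exists d, x = tofrac d) ->
  exists (L : fieldExtType K) (iota : {rmorphism D -> L}),
    (forall r, iota (f r) = (i r)%:A) /\ is_integral_closure (iota \o f) iota.
Proof.
move=> f_inj se closed.
have tofrac_inj : injective (@tofrac D) by move=> x y /eqP; rewrite tofrac_eq => /eqP.
have [j jE] := fraction_lift (inj_comp tofrac_inj f_inj : injective ((@tofrac D) \o f)).
have span_frac : spans j (fun k : 'I_#|I| => tofrac (e (enum_val k))).
  move=> x; have [a [b [b0 ->]]] := fraction_quot x.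
  have [P [/monic_neq0 P0 _ /(dvd_scalar_of_root P0)/(_ b0)[y [c [c0 bE]]]]] :=
    spans_root_monic b se.
  have [d dE] := se (a * y).
  exists (fun k => i (d (enum_val k)) / i c).
  have fc0 : tofrac (f c) != 0 by rewrite tofrac_eq0 raddf_eq0.
  have y0 : y != 0.
    by apply: contraNneq c0 => y0; rewrite -(raddf_eq0 _ f_inj) /= -bE y0 mulr0.
  have -> : tofrac a / tofrac b = tofrac (a * y) / tofrac (f c).
    by rewrite -bE !rmorphM -mulf_div divff ?mulr1 // tofrac_eq0.
  rewrite dE rmorph_sum mulr_suml (reindex (@enum_val I predT)) /=; last first.
    exact/onW_bij/enum_val_bij.
  by apply: eq_bigr => k _; rewrite fmorph_div !jE rmorphM mulrAC.
have [L [phi [[psi phiK psiK] phiE]]] := spans_fieldExt span_frac.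
pose iota : {rmorphism D -> L} := phi \o (@tofrac D).
exists L, iota; split; first by move=> r; rewrite -phiE jE.
split; first exact: inj_comp (can_inj phiK) tofrac_inj.
move=> x; split=> [[P Pm]|[d _ <-]].
  have -> : map_poly (iota \o f) P = map_poly phi (map_poly (@tofrac D) (map_poly f P)).
    by rewrite -!map_poly_comp.
  rewrite -(psiK x) fmorph_root => Px.
  have [|d ->] := closed (psi x); last by exists d.
  by exists (map_poly f P); rewrite ?monic_map.
have [P [Pm _ Pd]] := spans_root_monic d se.
by exists P => //; rewrite map_poly_comp /= /root horner_map (rootP Pd) rmorph0.
Qed.

End FractionField.

(** * Prime characteristic: roots of generators and separability *)

Lemma Fp_rmorphism (p : nat) (A : nzRingType) :
  p \in [pchar A] -> inhabited {rmorphism 'F_p -> A}.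
Proof.
move=> chA; constructor.
exact: (GRing.in_alg (pPrimeCharType chA) : {rmorphism 'F_p -> pPrimeCharType chA}).
Qed.

Section PrimeCharacteristic.
Variable p : nat.
Hypothesis p_prime : prime p.
Let p_gt0 : (0 < p)%N := prime_gt0 p_prime.

Lemma exprDp (R : comNzRingType) (x y : R) : p \in [pchar R] ->
  (x + y) ^+ p = x ^+ p + y ^+ p.
Proof. by move=> chR; rewrite -!(pFrobenius_autE chR) rmorphD. Qed.

Lemma expr_sum_p (R : comNzRingType) (I : Type) (r : seq I) (F : I -> R) :
  p \in [pchar R] -> (\sum_(i <- r) F i) ^+ p = \sum_(i <- r) F i ^+ p.
Proof.
move=> chR; rewrite -(pFrobenius_autE chR) rmorph_sum /=.
by apply: eq_bigr => i _; rewrite pFrobenius_autE.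
Qed.

Lemma expFp (c : 'F_p) : c ^+ p = c.
Proof. by have := expf_card c; rewrite card_Fp. Qed.

Lemma exp_polyFp (q : {poly 'F_p}) : q ^+ p = q \Po 'X^p.
Proof.
have chP : p \in [pchar {poly 'F_p}] by rewrite pchar_poly pchar_Fp.
elim/poly_ind: q => [|q c IHq]; first by rewrite comp_poly0 expr0n gtn_eqF.
rewrite exprDp // exprMn IHq -rmorphXn /= expFp.
by rewrite comp_polyD comp_polyM comp_polyX comp_polyC.
Qed.

Section RootExtraction.
Variable D : idomainType.
Implicit Types f g : {rmorphism {poly 'F_p} -> D}.

(** Put [y = g 'X] and [n = #|I|].  Over the base ring generated by [y ^ N], the element
    [y] satisfies a monic equation of degree [n]; written as a polynomial in [y] over
    ['F_p], its coefficient of degree [n] is 1 when [n < N], since all other terms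
    have degree congruent to some [i < n] modulo [N].  But [y] is transcendental. *)
Lemma spans_Frobenius_bound f g (N : nat) (I : finType) (e : I -> D) :
  injective g -> (forall q, f q = g (q \Po 'X^N)) -> spans f e -> (N <= #|I|)%N.
Proof.
move=> g_inj fE se; rewrite leqNgt; apply/negP => IN.
have [P [Pm szP /rootP]] := spans_root_monic (g 'X) se.
rewrite /map_poly horner_poly szP => P0.
pose Q := \sum_(i < #|I|.+1) (P`_i \Po 'X^N) * 'X^i.
have Q0 : Q = 0.
  apply: g_inj; rewrite rmorph0 -[RHS]P0 rmorph_sum; apply: eq_bigr => i _.
  by rewrite rmorphM rmorphXn /= -fE.
have : Q`_#|I| = 1; last by rewrite Q0 coef0 => /eqP; rewrite eq_sym oner_eq0.
have N0 : (0 < N)%N by rewrite (leq_ltn_trans _ IN).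
rewrite coef_sum big_ord_recr /= big1 => [|i _].
  have -> : P`_#|I| = 1 by move: Pm => /monicP; rewrite /lead_coef szP.
  by rewrite comp_polyC mul1r coefXn eqxx add0r.
have iI := ltn_ord i; rewrite coefMXn ltnNge ltnW //= coef_comp_poly_Xn //.
by rewrite gtnNdvd ?subn_gt0 // (leq_ltn_trans (leq_subr _ _)).
Qed.

(** [g] sends ['X] to [y].  It is injective because [g q ^ p = g (q \Po 'X^p) = f q]. *)
Lemma Frobenius_root f (y : D) : injective f -> y ^+ p = f 'X ->
  exists g, injective g /\ forall q, f q = g (q \Po 'X^p).
Proof.
move=> f_inj yp.
pose h : {rmorphism 'F_p -> D} := f \o polyC.
pose g : {rmorphism {poly 'F_p} -> D} := horner_morph (fun a => mulrC y (h a)).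
have fE q : f q = g (q \Po 'X^p).
  elim/poly_ind: q => [|q c IHq]; first by rewrite comp_poly0 !rmorph0.
  rewrite comp_polyD comp_polyM comp_polyX comp_polyC !rmorphD !rmorphM rmorphXn IHq.
  by rewrite /= horner_morphX horner_morphC yp.
exists g; split=> //; apply: raddf_inj => q gq0.
apply: f_inj; rewrite rmorph0 fE -exp_polyFp rmorphXn /= gq0 expr0n.
by rewrite gtn_eqF.
Qed.

(** Otherwise [p]-th roots of [f 'X] can be taken arbitrarily often, against
    [spans_Frobenius_bound]. *)
Lemma exists_non_power_generator f (I : finType) (e : I -> D) :
  injective f -> spans f e ->
  exists g, [/\ injective g, spans g e & forall y, y ^+ p != g 'X].
Proof.
move=> f_inj se; apply: contrapT => none.
have span_g g N : (forall q, f q = g (q \Po 'X^N)) -> spans g e.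
  move=> fE x; have [c ->] := se x; exists (fun i => c i \Po 'X^N).
  by apply: eq_bigr => i _; rewrite fE.
have : exists g, injective g /\ forall q, f q = g (q \Po 'X^(p ^ #|I|.+1)).
  elim: (#|I|.+1) => [|k [g [g_inj gE]]].
    by exists f; split=> // q; rewrite expn0 comp_polyXr.
  have [y yp] : exists y, y ^+ p = g 'X.
    apply: contrapT => noy; apply: none; exists g; split=> //; first exact: span_g gE.
    by move=> y; apply/eqP => yp; apply: noy; exists y.
  have [g' [g'_inj g'E]] := Frobenius_root g_inj yp.
  exists g'; split=> // q; rewrite gE g'E -comp_polyA; congr (g' (_ \Po _)).
  by rewrite comp_Xn_poly -exprM expnS.
move=> [g [g_inj gE]]; have := spans_Frobenius_bound g_inj gE se.
by rewrite leqNgt (leq_ltn_trans (leqnSn _)) // ltn_expl ?prime_gt1.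
Qed.

End RootExtraction.

(** Let [phi] be the Frobenius map.  A relation says that [phi q] vanishes at [t] for some
    [q] of degree less than [p]; so does [phi r] for [r = 'X^p - t], and therefore [phi m] for
    their monic gcd [m].  As [phi r = ('X - t) ^ p], [phi m] is a power [('X - t) ^ k]
    with [0 < k < p], whose second coefficient [- k * t] is a [p]-th power; then so is [t]. *)
Lemma indep_of_non_power (L : fieldType) (t : L) (c : 'I_p -> L) :
  p \in [pchar L] -> (forall y, y ^+ p != t) ->
  \sum_(i < p) t ^+ i * c i ^+ p = 0 -> forall i, c i = 0.
Proof.
move=> chL t_np sum0.
pose phi : {rmorphism L -> L} := pFrobenius_aut chL.
have phiE x : phi x = x ^+ p by exact: pFrobenius_autE.
pose q := \poly_(i < p) (if insub i is Some k then c k else 0).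
have qE (i : 'I_p) : q`_i = c i by rewrite coef_poly ltn_ord valK.
suff q0 : q = 0 by move=> i; rewrite -qE q0 coef0.
apply/eqP/negPn/negP => q0.
pose r : {poly L} := 'X^p - t%:P.
pose d := gcdp q r; pose m := (lead_coef d)^-1 *: d.
have d0 : d != 0 by rewrite gcdp_eq0 negb_and q0.
have ld0 : lead_coef d != 0 by rewrite lead_coef_eq0.
have m_monic : m \is monic by rewrite monicE lead_coefZ mulVf.
have sz_m : size m = size d by rewrite size_scale ?invr_eq0.
have phir : map_poly phi r = ('X - t%:P) ^+ p.
  have chP : p \in [pchar {poly L}] by rewrite pchar_poly.
  have -> : ('X - t%:P) ^+ p = 'X^p - (t ^+ p)%:P.
    by rewrite -(pFrobenius_autE chP) rmorphB /= !pFrobenius_autE polyC_exp.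
  by rewrite rmorphB /= map_polyXn map_polyC /= pFrobenius_autE.
have dt : root (map_poly phi d) t.
  rewrite gcdp_map root_gcd phir /root horner_exp hornerXsubC subrr expr0n.
  rewrite gtn_eqF // eqxx andbT -[X in _ == X]sum0; apply/eqP.
  have -> : map_poly phi q = \poly_(i < p) phi q`_i.
    apply/polyP => i; rewrite coef_map [RHS]coef_poly; case: ifPn => // /negPf ip.
    rewrite [q`_i]coef_poly ip; exact: rmorph0.
  by rewrite horner_poly; apply: eq_bigr => i _; rewrite qE phiE mulrC.
have mt : root (map_poly phi m) t by rewrite map_polyZ rootZ // fmorph_eq0 invr_eq0.
have : map_poly phi m %| ('X - t%:P) ^+ p.
  by rewrite -phir dvdp_map dvdpZl ?invr_eq0 // dvdp_gcdr.
move=> /dvdp_exp_XsubCP[k _].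
rewrite eqp_monic ?monic_map ?monic_exp ?monicXsubC // => /eqP mE.
have kp : (k < p)%N.
  have : (size (map_poly phi m) <= p)%N.
    rewrite size_map_poly sz_m (leq_trans (dvdp_leq q0 (dvdp_gcdl _ _))) //.
    exact: size_poly.
  by rewrite mE size_exp_XsubC.
have k0 : (0 < k)%N.
  by case: k mE {kp} mt => // ->; rewrite expr0 (negPf (root1 _)).
have kL : k%:R != 0 :> L by rewrite -(dvdn_pcharf chL) gtnNdvd.
have coefE : phi m`_k.-1 = - (t * k%:R).
  rewrite -coef_map mE.
  have := @coefPn_prod_XsubC L (nseq k t).
  rewrite size_nseq !big_nseq iter_mulr_1 iter_addr_0 mulr_natr; apply.
  by rewrite -lt0n.
have /negP[] := t_np (- m`_k.-1 / k%:R).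
by rewrite -phiE fmorph_div rmorphN coefE rmorph_nat opprK mulfK.
Qed.

Local Notation K := {fraction {poly 'F_p}}.

(** A monomial ['X^k] is ['X^(k %% p)] times a [p]-th power, constants of ['F_p] are [p]-th
    powers, and a denominator [y] can be replaced by [y ^ p]. *)
Lemma fraction_decomp (a : K) :
  exists c : 'I_p -> K, a = \sum_(i < p) tofrac 'X ^+ i * c i ^+ p.
Proof.
have chK : p \in [pchar K].
  apply: (rmorph_pchar (@tofrac {poly 'F_p})); rewrite pchar_poly; exact: pchar_Fp.
pose S (a : K) := exists c : 'I_p -> K, a = \sum_(i < p) tofrac 'X ^+ i * c i ^+ p.
have SD x y : S x -> S y -> S (x + y).
  move=> [c ->] [d ->]; exists (fun i => c i + d i); rewrite -big_split.
  by apply: eq_bigr => i _; rewrite exprDp // mulrDr.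
have SZ x y : S y -> S (x ^+ p * y).
  move=> [c ->]; exists (fun i => x * c i); rewrite mulr_sumr.
  by apply: eq_bigr => i _; rewrite exprMn mulrCA.
have S0 : S 0.
  exists (fun=> 0); rewrite big1 // => i _; rewrite expr0n gtn_eqF //.
  by rewrite mulr0.
have SX k : S (tofrac 'X ^+ k).
  rewrite (divn_eq k p) exprD exprM; apply: SZ.
  pose j := Ordinal (ltn_pmod k p_gt0); exists (fun i => (i == j)%:R).
  rewrite (bigD1 j) //= eqxx expr1n mulr1 big1 ?addr0 // => i /negPf->.
  by rewrite expr0n gtn_eqF // mulr0.
have Spoly (P : {poly 'F_p}) : S (tofrac P).
  rewrite -[P]coefK poly_def rmorph_sum; elim/big_rec: _ => // i x _ Sx.
  apply: SD => //; rewrite -mul_polyC rmorphM rmorphXn -[P`_i]expFp polyC_exp rmorphXn.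
  exact: SZ.
change (S a); have [x [y [y0 ->]]] := fraction_quot a.
have -> : tofrac x / tofrac y = (tofrac y)^-1 ^+ p * tofrac (x * y ^+ p.-1).
  have ty0 : tofrac y != 0 by rewrite tofrac_eq0.
  have invE k : (0 < k)%N -> (tofrac y)^-1 = (tofrac y)^-1 ^+ k * tofrac y ^+ k.-1.
    by case: k => // k _; rewrite exprS -mulrA -exprMn mulVf // expr1n mulr1.
  by rewrite rmorphM rmorphXn mulrCA; congr (_ * _); exact: invE.
exact: SZ.
Qed.

(** If [y] is inseparable, its minimal polynomial is [g \Po 'X^p].  Splitting the
    coefficients of [g] by [fraction_decomp] turns [g.[y ^ p] = 0] into the relation
    [\sum_i t ^ i * (h i).[y] ^ p = 0], where the [h i] have degree at most that of [g].
    By independence every [h i] vanishes at [y]; its degree being less than that of the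
    minimal polynomial, [h i = 0], and so [g = 0]. *)
Lemma separable_of_non_power (L : fieldExtType K) :
  (forall y : L, y ^+ p != (tofrac 'X)%:A) -> separable 1 {:L}.
Proof.
move=> t_np; set t := (tofrac 'X)%:A in t_np.
have chL : p \in [pchar L].
  rewrite pchar_lalg; apply: (rmorph_pchar (@tofrac {poly 'F_p})).
  by rewrite pchar_poly; exact: pchar_Fp.
apply/separableP => y _; apply/negPn/negP => /separablePn_pchar[p' chp' [g g1 minE]].
have p'p : p' = p by apply/eqP; rewrite (pcharf_eq chL) in chp'.
rewrite {}p'p {chp'} in minE.
have /choice[a aE] k : exists a : K, g`_k = a%:A.
  by have /vlineP[a aE] := polyOverP g1 k; exists a.
have /choice[c cE] k := fraction_decomp (a k).
pose h i := \poly_(k < size g) (c k i)%:A : {poly L}.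
have h1 i : h i \is a polyOver 1%VS.
  by apply/polyOverP => k; rewrite coef_poly; case: ifP; rewrite ?rpred0 ?rpredZ ?mem1v.
have gy : g.[y ^+ p] = 0.
  by have := root_minPoly 1 y; rewrite minE => /rootP; rewrite horner_comp hornerXn.
have sum0 : \sum_(i < p) t ^+ i * (h i).[y] ^+ p = 0.
  transitivity (\sum_(k < size g) g`_k * (y ^+ p) ^+ k); last by rewrite -horner_coef.
  rewrite (eq_bigr (fun i : 'I_p =>
    \sum_(k < size g) t ^+ i * ((c k i)%:A * y ^+ k) ^+ p)).
    rewrite exchange_big; apply: eq_bigr => k _.
    rewrite aE {1}cE scaler_suml mulr_suml; apply: eq_bigr => i _.
    rewrite exprMn mulrA -!exprM mulnC; congr (_ * _).
    by rewrite -!in_algE rmorphM !rmorphXn.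
  by move=> i _; rewrite horner_poly expr_sum_p // mulr_sumr.
have min_neq0 : minPoly 1 y != 0 by rewrite monic_neq0 ?monic_minPoly.
have g0 : g != 0.
  by apply: contraNneq min_neq0 => g0; rewrite minE g0 comp_poly0.
have sz_g : (size g < size (minPoly 1 y))%N.
  have : (1 < size (minPoly 1 y))%N.
    exact: root_size_gt1 min_neq0 (root_minPoly _ _).
  have := size_comp_poly g 'X^p; rewrite -minE size_polyXn /=.
  have := prime_gt1 p_prime; case: (size g) => [|[|n]] /=; first by lia.
    by rewrite mul0n; lia.
  by move: (size _) => m p1 mE m1; have := leq_mul (leqnn n.+1) p1; lia.
have h0 i : h i = 0.
  apply/eqP/negPn/negP => hi0.
  have /(minPoly_dvdp (h1 i))/(dvdp_leq hi0) : root (h i) y.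
    exact/rootP/(indep_of_non_power chL t_np sum0).
  by rewrite leqNgt (leq_ltn_trans _ sz_g) ?size_poly.
move/negP: g0; apply; apply/eqP/polyP => k; rewrite coef0.
have [kg|kg] := ltnP k (size g); last by rewrite nth_default.
rewrite aE cE big1 ?scale0r // => i _.
have : (h i)`_k = 0 by rewrite h0 coef0.
rewrite coef_poly kg => /eqP; rewrite scaler_eq0 oner_eq0 orbF => /eqP ->.
by rewrite expr0n gtn_eqF // mulr0.
Qed.

End PrimeCharacteristic.

(** * Rings of integers of global fields *)

(** Two of the integers [0, ..., size s] are congruent modulo [a]; their difference is
    a multiple of [a]. *)
Lemma pchar0_nonunit_nat (A : idomainType) (a : A) :
  finite_quotients A -> [pchar A] =i pred0 -> a != 0 -> (forall b, a * b != 1) ->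
  exists n : nat, n%:R != 0 :> A /\ forall b : A, n%:R * b != 1.
Proof.
move=> finA ch0 a0 aU; have [s [_ cov _] _] := transversal_ideal_norm finA a0.
have /choice[g gP] (k : nat) : exists r, r \in s /\ exists z, k%:R = r + a * z.
  by have [r rs kr] := cov k%:R; exists r.
pose l := [seq g k | k <- iota 0 (size s).+1].
have : ~~ uniq l.
  apply/negP => ul; have : (size l <= size s)%N.
    by apply: uniq_leq_size ul _ => _ /mapP[k _ ->]; case: (gP k).
  by rewrite size_map size_iota ltnn.
move=> /(uniqPn 0)[i [k [ik]]]; rewrite size_map size_iota => kl.
have il := ltn_trans ik kl.
rewrite !(nth_map 0%N) ?size_iota // !nth_iota // !add0n => gik.
have [_ [z iE]] := gP i; have [_ [w kE]] := gP k.
have dE : (k - i)%:R = a * (w - z).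
  by rewrite natrB 1?ltnW // kE iE gik; ring.
exists (k - i)%N; split.
  by move: ch0 => /pcharf0P ->; rewrite subn_eq0 -ltnNge.
by move=> b; rewrite dE -mulrA.
Qed.

Section GlobalField.
Variables (A D : idomainType) (g : {rmorphism A -> D}) (I : finType) (e : I -> D).
Hypotheses (finA : finite_quotients A) (triA : quasi_triangle A).
Hypotheses (g_inj : injective g) (se : spans g e).
Hypothesis closedD :
  forall x : {fraction D}, integralOver (@tofrac D) x -> exists d, x = tofrac d.
Variable a : A.
Hypotheses (a0 : a != 0) (aU : forall b, a * b != 1).

Lemma pchar0_number_field_integers :
  [pchar A] =i pred0 -> is_number_field_integers D.
Proof.
move=> ch0; have [n [n0 nU]] := pchar0_nonunit_nat finA ch0 a0 aU.
pose z : {rmorphism int -> A} := intmul 1.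
have z_inj : injective z.
  apply: raddf_inj => -[] m /eqP; rewrite /= ?NegzE ?rmorphN ?oppr_eq0;
    by move: ch0 => /pcharf0P ->  => // /eqP ->.
have [J [e' se']] := quasi_triangle_spans finA triA (f := z) (r := n%:Z) n0 nU.
pose i : {rmorphism int -> rat} := intmul 1.
have i_quot (k : rat) : exists a b, b != 0 /\ k = i a / i b.
  by exists (numq k), (denq k); rewrite denq_neq0 divq_num_den.
have [L [iota [iotaE closedL]]] :=
  integral_closure_in_fieldExt (intr_inj : injective i) i_quot
    (inj_comp g_inj z_inj : injective (g \o z)) (spans_trans se' se) closedD.
exists L, iota.
have -> // : (fun m : int => m%:~R : L) = iota \o (g \o z).
by apply/funext => m; rewrite /= !rmorph_int.
Qed.

Lemma pcharp_function_field_integers p :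
  p \in [pchar A] -> is_function_field_integers D.
Proof.
move=> chA; have p_prime := pcharf_prime chA.
have [h] := Fp_rmorphism chA.
pose f : {rmorphism {poly 'F_p} -> A} := horner_morph (fun c => mulrC a (h c)).
have fE q c : f (q * 'X + c%:P) = f q * a + h c.
  by rewrite rmorphD rmorphM /= horner_morphX horner_morphC.
(* [a] is transcendental: after removing factors ['X], a relation exhibits a nonzero
   constant, which is a unit, as a multiple of [a]. *)
have f_inj : injective f.
  apply: raddf_inj; elim/poly_ind => // q c IHq; rewrite -[X in X = _]/(f _) fE => E.
  have c0 : c = 0.
    apply/eqP/negPn/negP => c0; have /negP[] := aU (- f q * h c^-1); apply/eqP.
    have hc0 : h c * h c^-1 = 1 by rewrite -rmorphM divff ?rmorph1.
    have hc : h c = - (f q * a) by apply/eqP; rewrite -addr_eq0 addrC E.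
    by rewrite -hc0 hc mulrA mulrN [a * _]mulrC.
  move: E => /eqP; rewrite c0 rmorph0 !addr0 mulf_eq0 (negPf a0) orbF.
  by move=> /eqP/IHq ->; rewrite mul0r.
have fX : f 'X = a by rewrite /= horner_morphX.
have [||J [e' se']] := quasi_triangle_spans finA triA (f := f) (r := 'X); rewrite ?fX //.
have [G [G_inj sG G_np]] := exists_non_power_generator p_prime
  (inj_comp g_inj f_inj : injective (g \o f)) (spans_trans se' se).
have tofrac_inj : injective (@tofrac {poly 'F_p}).
  by move=> x y /eqP; rewrite tofrac_eq => /eqP.
have [L [iota [iotaE [iota_inj closedL]]]] :=
  integral_closure_in_fieldExt tofrac_inj (@fraction_quot _) G_inj sG closedD.
(* One element serves both as separating transcendental and as generator of the base
   ring. *)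
pose s := iota (G 'X).
have evE q : (map_poly (@const_emb _ L) q).[s] = iota (G q).
  rewrite (eq_map_poly (g := iota \o G \o polyC)) => [|c]; last by rewrite /= iotaE.
  elim/poly_ind: q => [|q c IHq]; first by rewrite !rmorph0 horner0.
  by rewrite !rmorphD !rmorphM /= map_polyX map_polyC hornerD hornerMX hornerC IHq.
exists 'F_p, L, s, iota; split.
- apply: separable_of_non_power => // y; apply/eqP => yp.
  have /closedL[d _ dy] : integralOver (iota \o G) y.
    exists ('X^p - 'X%:P); first by rewrite monicXnsubC // prime_gt0.
    by rewrite /root rmorphB /= map_polyXn map_polyC !hornerE /= yp iotaE subrr.
  by have /eqP[] := G_np d; apply: iota_inj; rewrite rmorphXn /= dy yp iotaE.
- move=> [q q0]; rewrite /root evE (raddf_eq0 _ iota_inj) (raddf_eq0 _ G_inj).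
  exact/negP.
- have -> // : (fun q : {poly 'F_p} => (map_poly (@const_emb _ L) q).[s]) = iota \o G.
  by apply/funext => q; rewrite evE.
Qed.

Lemma global_field_integers : is_global_field_integers D.
Proof.
have [[p chA]|ch0] := pselect (exists p, p \in [pchar A]).
  by right; exact: pcharp_function_field_integers chA.
left; apply: pchar0_number_field_integers => p; apply/negP => chA.
by apply: ch0; exists p.
Qed.

End GlobalField.

(** Inverses come from the axiom of choice.  The conclusion is an equality of ring
    structures, so that statements about [R] itself can be transported. *)
Lemma integral_domain_idomainType (R : comNzRingType) :
  GRing.integral_domain_axiom R -> exists D : idomainType, D = R :> comNzRingType.
Proof.
(* Exposing the components of [R] makes the final equality definitional. *)
case: R => T [? ? ? ? ? ? ? ? ? ? ? ?].
match goal with |- GRing.integral_domain_axiom ?S -> _ => pose R := S : comNzRingType end.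
rewrite -/R => domR.
pose unit : pred R := fun x => `[< exists y, y * x = 1 >].
pose inv x := if unit x then xget 0 [set y | y * x = 1] else x.
have mulVx : {in unit, left_inverse 1 inv *%R}.
  move=> x ux; rewrite /inv (ux : unit x).
  by have /asboolP[y yx] := ux; case: xgetP => // /(_ y).
have unitPl x y : y * x = 1 -> unit x by move=> yx; apply/asboolP; exists y.
have inv_out : {in [predC unit], inv =1 id}.
  by move=> x ux; rewrite /inv (negPf (ux : ~~ unit x)).
pose uM := GRing.ComNzRing_hasMulInverse.Build R mulVx unitPl inv_out.
pose U : comUnitRingType := HB.pack R uM.
pose iM := GRing.ComUnitRing_isIntegral.Build U domR.
pose D : idomainType := HB.pack U iM.
by exists D.
Qed.

Lemma global_field_integers_of_spans (A : idomainType) (B : comNzRingType)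
    (g : {rmorphism A -> B}) (I : finType) (e : I -> B) :
  finite_quotients A -> quasi_triangle A -> injective g -> spans g e ->
  is_Dedekind_domain B ->
  forall a : A, a != 0 -> (forall b, a * b != 1) -> is_global_field_integers B.
Proof.
move=> finA triA g_inj se dedB a a0 aU.
have [D DB] := integral_domain_idomainType dedB.1.
case: B / DB in g e g_inj se dedB *.
exact: (@global_field_integers A D g I e finA triA g_inj se
  (Dedekind_integrally_closed dedB) a a0 aU).
Qed.

Theorem corollary13 (A : idomainType) (B : comAlgType A) :
  (is_finite_quotient_PID A -> ~ GRing.field_axiom A -> quasi_triangle A ->
   is_Dedekind_domain B -> fg_free_module B ->
   is_global_field_integers B)
  /\
  (is_basic_PID A -> is_class_G B -> is_global_field_integers B).
Proof.
have main : finite_quotients A -> ~ GRing.field_axiom A -> quasi_triangle A ->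
   is_Dedekind_domain B -> fg_free_module B -> is_global_field_integers B.
  move=> finA nfA triA dedB [n [e eP]].
  have [a [a0 aU]] : exists a : A, a != 0 /\ forall b, a * b != 1.
    apply: contrapT => none; apply: nfA => a a0; apply: contrapT => aU.
    apply: none; exists a; split=> // b; apply/eqP => ab1; apply: aU.
    by apply/unitrP; exists b; rewrite mulrC ab1.
  have se : spans (GRing.in_alg B) e.
    move=> x; have [c [cE _]] := eP x; exists c; rewrite cE.
    by apply: eq_bigr => i _; rewrite mulr_algl.
  (* If [x] acts as 0, then 0 has the constant family [x] as coordinates. *)
  have alg_inj : injective (GRing.in_alg B).
    apply: raddf_inj => x /= x0.
    have ze (c : {ffun 'I_n -> A}) : c = 0 \/ c = [ffun=> x] -> 0 = \sum_i c i *: e i.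
      move=> cE; rewrite big1 // => i _; rewrite -mulr_algl.
      by case: cE => ->; rewrite ffunE ?scale0r ?x0 mul0r.
    have [c [_ c_uniq]] := eP 0.
    have E : [ffun=> x] = 0 :> {ffun 'I_n -> A}.
      by rewrite -(c_uniq _ (ze _ (or_intror erefl))) (c_uniq _ (ze 0 (or_introl erefl))).
    case: n {ze c c_uniq} e eP se E => [|n] e eP se E.
      have [c] := se 1; rewrite big_ord0 => /eqP; by rewrite oner_eq0.
    by have /ffunP/(_ ord0) := E; rewrite !ffunE.
  exact: (@global_field_integers_of_spans A B (GRing.in_alg B) _ e finA triA alg_inj se dedB a).
split.
  by move=> [_ finA] nfA triA; exact: main.
by move=> [_ nfA finA _ triA] [dedB fgB]; exact: main.
Qed.
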